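(* If $p$ is an even positive integer, then \begin{multline*} t(p+1,1)=t(p+1)\log2-\frac12\zeta(\overline{p+1},1)+\frac{(p+1)(1-2^{p+1})-2^{p+2}}{4(2^{p+2}-1)}t(p+2)\\ +\frac12\sum_{i=1}^{\frac{p-2}{2}}\frac{2^{p+1}-2^{2i+1}-2^{p+1-2i}+1}{(2^{2i+1}-1)(2^{p+1-2i}-1)}t(2i+1)t(p+1-2i). \end{multline*}
   Context: $t(i_1,\dots,i_k)=\sum_{n_1>\cdots>n_k\ge1,\ n_j\text{ odd}}n_1^{-i_1}\cdots n_k^{-i_k}$ (for $k=1$, $t(i)=\sum_{m\text{ odd}}m^{-i}$). The alternating double zeta value is $\zeta(\overline{p+1},1)=\sum_{m>n\ge1}\frac{(-1)^m}{m^{p+1}n}$. The sum over $i$ is empty when $p=2$. *)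

(* Defs.v *)
From mathcomp Require Export all_boot all_order all_algebra.
From mathcomp Require Export all_classical all_reals all_analysis.
Export Order.TTheory GRing.Theory Num.Theory.
Export numFieldNormedType.Exports.

Set Implicit Arguments.
Unset Strict Implicit.
Unset Printing Implicit Defensive.

Local Open Scope ring_scope.

(* The sum of n_1^{-i_1} ... n_k^{-i_k} over odd N > n_1 > ... > n_k >= 1,
   where s = [:: i_1; ...; i_k]; the empty word gives 1. *)
Fixpoint tval_trunc (R : realType) (s : seq nat) (N : nat) : R :=
  if s is i :: s' then
    \sum_(1 <= n < N | odd n) (n%:R ^- i * tval_trunc R s' n)
  else 1.

(* t(i_1, ..., i_k): the outermost (largest) variable n_1 tends to infinity.
   [limn] is total, and is the sum of the series only when the series
   converges; for positive exponents and k >= 1 this means i_1 >= 2. *)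
Definition tval (R : realType) (s : seq nat) : R := limn (tval_trunc R s).

Definition alt_zeta2_trunc (R : realType) (a b N : nat) : R :=
  \sum_(1 <= m < N) \sum_(1 <= n < m) ((-1) ^+ m / (m%:R ^+ a * n%:R ^+ b)).

(* zeta(\bar a, b), the sum of (-1)^m / (m^a n^b) over m > n >= 1. *)
Definition alt_zeta2 (R : realType) (a b : nat) : R :=
  limn (alt_zeta2_trunc R a b).

(* Main.v *)
Require Import Defs.
From mathcomp Require Import ring lra zify.

Set Implicit Arguments.
Unset Strict Implicit.
Unset Printing Implicit Defensive.

Local Open Scope classical_set_scope.
Local Open Scope ring_scope.

(* Write p = 2K + 2 and a = p + 1. For m <> n the sum over odd x with
   3 <= x <= a - 2 of m^-x n^-(p + 2 - x) is geometric and equals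
     m^-a g(n, m) + n^-a g(m, n),
     g(n, m) = 1/(2(n - m)) + 1/(2(n + m)) - 1/n.
   Summing g(n, m) over n telescopes to harmonic numbers. With m, n ranging
   over all positive integers this expresses the sum of zeta(x) zeta(p + 2 - x)
   by zeta(a, 1), as in Euler's formula; with m, n odd it expresses the sum of
   t(x) t(p + 2 - x) by log 2 * t(a) and the sum over odd m > even n of
   1/(m^a n). As zeta(a, 1) - zeta(\bar a, 1) is twice the sum over odd m and
   all n < m, the combination t t - zeta zeta / 2 eliminates zeta(a, 1), and the
   coefficients of the statement are those of t t - zeta zeta / 2 rewritten with
   t(x) = (1 - 2^-x) zeta(x). All identities are proved for sums over the first
   M indices, with an error that tends to 0. *)

(** * Partial fractions for products of odd powers *)

Definition kernel_term (R : realFieldType) (a b : R) : R :=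
  2^-1 * (a - b)^-1 + 2^-1 * (a + b)^-1 - a^-1.

(** Since [kernel_term a b] equals b^2 / (a (a^2 - b^2)), the right-hand side is the closed form of
    a geometric sum and vanishes at K = 0. Passing to K + 1 multiplies the old terms by b^-2 and
    adds a^-(2K+3) b^-3. *)
Lemma sum_odd_exponents_neq (R : realFieldType) (a b : R) (K : nat) :
  0 < a -> 0 < b -> a != b ->
  \sum_(0 <= i < K) a ^- (2 * i + 3) * b ^- (2 * (K - i) + 1) =
  b ^- (2 * K + 3) * kernel_term a b + a ^- (2 * K + 3) * kernel_term b a.
Proof.
rewrite /kernel_term => a0 b0 ab.
have aN0 : a != 0 by rewrite gt_eqF.
have bN0 : b != 0 by rewrite gt_eqF.
have abN0 : a - b != 0 by rewrite subr_eq0.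
have baN0 : b - a != 0 by rewrite subr_eq0 eq_sym.
have sN0 : a + b != 0 by rewrite gt_eqF ?addr_gt0.
have s'N0 : b + a != 0 by rewrite addrC.
elim: K => [|K IH].
  by rewrite big_geq // muln0 add0n; field; rewrite ?bN0 ?aN0 ?sN0 ?s'N0 ?abN0 ?baN0.
rewrite big_nat_recr //= (_ : (2 * (K.+1 - K) + 1 = 3)%N); last by lia.
under eq_big_nat => i /andP[_ iK].
  rewrite (_ : (2 * (K.+1 - i) + 1 = 2 + (2 * (K - i) + 1))%N); last by lia.
  rewrite (exprD b 2) invfM mulrCA.
  over.
rewrite -big_distrr /= IH.
rewrite (_ : (2 * K.+1 + 3 = 2 + (2 * K + 3))%N); last by lia.
rewrite (exprD a 2 (2 * K + 3)) (exprD b 2 (2 * K + 3)) !invfM.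
move: (a ^- (2 * K + 3)) (b ^- (2 * K + 3)) => A B.
by field; rewrite ?bN0 ?aN0 ?sN0 ?s'N0 ?abN0 ?baN0.
Qed.

(* With [0^-1 = 0] the singular term of [kernel_term b b] vanishes, leaving
   [- 3 / (4 * b)]; the correction below compensates exactly this. *)
Lemma sum_odd_exponents (R : realFieldType) (a b : R) (K : nat) :
  0 < a -> 0 < b ->
  \sum_(0 <= i < K) a ^- (2 * i + 3) * b ^- (2 * (K - i) + 1) =
  b ^- (2 * K + 3) * (kernel_term a b + (a == b)%:R * (3 / (4 * b)))
  + a ^- (2 * K + 3) * (kernel_term b a + (a == b)%:R * (3 / (4 * a)))
  + (a == b)%:R * K%:R * a ^- (2 * K + 4).
Proof.
move=> a0 b0; have [<-|ab] := eqVneq a b; last first.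
  by rewrite !mul0r !addr0 sum_odd_exponents_neq.
rewrite /kernel_term subrr invr0 !mul1r.
rewrite (_ : _ + 3 / _ = 0); last by field; rewrite gt_eqF //= gt_eqF ?addr_gt0.
rewrite mulr0 !add0r (eq_big_nat _ _ (F2 := fun=> a ^- (2 * K + 4))); last first.
  by move=> i /andP[_ iK]; rewrite -invfM -exprD; congr (_ ^- _); lia.
by rewrite big_const_nat subn0 iter_addr_0 mulr_natl.
Qed.

(** The products are expanded and [sum_odd_exponents] is applied to each pair (c j, c k). Exchanging
    j and k maps one kernel half to the other, whence the factor 2; the diagonal j = k gives the
    term with K and the correction 3 / (4 c k). *)
Lemma sum_products_odd_exponents (R : realFieldType) (c : nat -> R) (K M : nat) :
  injective c -> (forall j, 0 < c j) ->
  \sum_(0 <= i < K) (\sum_(0 <= j < M) c j ^- (2 * i + 3)) *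
                    (\sum_(0 <= k < M) c k ^- (2 * (K - i) + 1)) =
  K%:R * (\sum_(0 <= k < M) c k ^- (2 * K + 4)) +
  2 * \sum_(0 <= k < M) c k ^- (2 * K + 3) *
     (\sum_(0 <= j < M) kernel_term (c j) (c k) + 3 / (4 * c k)).
Proof.
move=> inj c0.
under eq_bigr => i _.
  rewrite big_distrl /=.
  under eq_bigr => j _ do rewrite big_distrr /=.
  over.
rewrite exchange_big /=.
under eq_bigr => j _.
  rewrite exchange_big /=.
  under eq_bigr => k _ do rewrite sum_odd_exponents // !(inj_eq inj).
  rewrite !big_split /=.
  over.
have pick (F : nat -> nat -> R) :
    \sum_(0 <= j < M) \sum_(0 <= k < M) (j == k)%:R * F j k =
    \sum_(0 <= j < M) F j j.
  apply: eq_big_nat => j jM.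
  rewrite (bigD1_seq j) ?mem_index_iota ?iota_uniq //= eqxx mul1r.
  by rewrite big1 ?addr0 // => k; rewrite eq_sym => /negPf ->; rewrite mul0r.
have half : \sum_(0 <= j < M) \sum_(0 <= k < M) c j ^- (2 * K + 3) *
    (kernel_term (c k) (c j) + (j == k)%:R * (3 / (4 * c j))) =
    \sum_(0 <= k < M) c k ^- (2 * K + 3) *
     (\sum_(0 <= j < M) kernel_term (c j) (c k) + 3 / (4 * c k)).
  under eq_bigr => j _ do under eq_bigr => k _ do rewrite mulrDr (mulrCA _ _%:R).
  under eq_bigr => j _ do rewrite big_split /=.
  rewrite big_split /= pick -big_split /=.
  by apply: eq_bigr => j _; rewrite mulrDr big_distrr.
rewrite !big_split /= half.
under [X in _ + X = _]eq_bigr => j _ do under eq_bigr => k _ do rewrite -mulrA.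
rewrite pick exchange_big /=.
under [X in X + _ + _ = _]eq_bigr => j _ do under eq_bigr => k _ do rewrite eq_sym.
rewrite half -big_distrr /=.
set X := \sum_(0 <= k < M) _ * (_ + _).
ring.
Qed.

(** * Kernel sums as harmonic numbers *)

(** As [harmonic] starts at 1/1, [H n] is 1 + 1/2 + ... + 1/n, with [H 0] = 0. *)
Local Notation H := (series harmonic).

(** The term j = k is 0 by the convention 0^-1 = 0; indices above k give the first harmonic number,
    those below k the second with a minus sign. *)
Lemma sum_inv_sub (R : realType) (k M : nat) : (k < M)%N ->
  \sum_(0 <= j < M) (j%:R - k%:R : R)^-1 = H (M - k.+1)%N - H k.
Proof.
move=> kM; rewrite (big_cat_nat (n := k.+1)) //= big_nat_recr //= subrr invr0 addr0.
rewrite addrC; congr (_ + _).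
  rewrite -{1}(add0n k.+1) big_addn seriesEnat /=; apply: eq_bigr => j _.
  by congr (_^-1); rewrite -natrB; [congr (_%:R)|]; lia.
rewrite seriesEnat /= big_nat_rev /= -sumrN; apply: eq_big_nat => j /andP[_ jk].
by rewrite -invrN -opprB; congr ((- _)^-1); rewrite -natrB; [congr (_%:R)|]; lia.
Qed.

Lemma sum_inv_add (R : realType) (k M : nat) :
  \sum_(0 <= j < M) (j.+1%:R + k%:R : R)^-1 = H (M + k)%N - H k.
Proof.
rewrite !seriesEnat /= [in RHS](big_cat_nat (n := k)) //= ?leq_addl//.
rewrite [X in _ = X - _]addrC addrK -{2}(add0n k) big_addn addnK.
by apply: eq_bigr => j _; rewrite -natrD addSn.
Qed.
(** The combination of harmonic numbers with factor 1/2 is the truncation error; the remaining terms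
    do not depend on M. *)
Lemma sum_kernel_all (R : realType) (k M : nat) : (k < M)%N ->
  \sum_(0 <= j < M) kernel_term (j.+1%:R : R) k.+1%:R + 3 / (4 * k.+1%:R) =
  2^-1 * (H (M - k.+1)%N + H (M + k.+1)%N - 2 * H M) - H k + (4 * k.+1%:R)^-1.
Proof.
move=> kM; rewrite /kernel_term !big_split /= -!big_distrr /= sumrN sum_inv_add.
under eq_bigr => j _.
  rewrite (_ : j.+1%:R - k.+1%:R = j%:R - k%:R); last by rewrite -!natr1; ring.
  over.
have -> : \sum_(0 <= j < M) j.+1%:R^-1 = H M :> R by rewrite seriesEnat.
have -> : H k.+1 = H k + k.+1%:R^-1 :> R by rewrite seriesSr.
rewrite sum_inv_sub //.
have : k.+1%:R != 0 :> R by rewrite pnatr_eq0.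
by move: k.+1%:R => m mN0; field.
Qed.

(** Sums and differences of odd numbers are even, so halving them gives full harmonic numbers again.
    The last bracket is H(2M) - H(M), the source of log 2. *)
Lemma sum_kernel_odd (R : realType) (k M : nat) : (k < M)%N ->
  \sum_(0 <= j < M) kernel_term ((2 * j).+1%:R : R) (2 * k).+1%:R
    + 3 / (4 * (2 * k).+1%:R) =
  4^-1 * (H (M - k.+1)%N + H (M + k)%N - 2 * H M) - 2^-1 * H k
  + 3 / (4 * (2 * k).+1%:R)
  - (\sum_(0 <= j < M) (2 * j).+1%:R^-1 - 2^-1 * H M).
Proof.
move=> kM; rewrite /kernel_term !big_split /= -!big_distrr /= sumrN.
under eq_bigr => j _.
  rewrite (_ : (2 * j).+1%:R - (2 * k).+1%:R = 2 * (j%:R - k%:R)); last first.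
    by rewrite -!natr1 !natrM; ring.
  rewrite invfM.
  over.
under [X in _ * _ + _ * X - _]eq_bigr => j _.
  rewrite (_ : (2 * j).+1%:R + (2 * k).+1%:R = 2 * (j.+1%:R + k%:R)); last first.
    by rewrite -!natr1 !natrM; ring.
  rewrite invfM.
  over.
rewrite -!big_distrr /= sum_inv_sub // sum_inv_add.
have : (2 * k).+1%:R != 0 :> R by rewrite pnatr_eq0.
by move: (2 * k).+1%:R => m mN0; field.
Qed.

(** * Harmonic estimates and the vanishing of the error *)

Lemma harmonic_series_diff_ge0 (R : realType) (n m : nat) : (n <= m)%N ->
  0 <= H m - H n :> R.
Proof.
move=> nm; rewrite subr_ge0 !seriesEnat /= [leRHS](big_cat_nat (n := n)) //=.
by rewrite lerDl sumr_ge0 // => i _; apply: harmonic_ge0.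
Qed.

Lemma harmonic_series_diff_le (R : realType) (n m : nat) : (n <= m)%N ->
  H m - H n <= (m - n)%:R / n.+1%:R :> R.
Proof.
move=> nm; rewrite !seriesEnat /= [in leLHS](big_cat_nat (n := n)) //=.
rewrite [X in X - _]addrC addrK.
apply: le_trans (_ : \sum_(n <= i < m) n.+1%:R^-1 <= _).
  apply: ler_sum_nat => i /andP[ni _]; rewrite lef_pV2 ?posrE ?ltr0n//.
  by rewrite ler_nat.
by rewrite big_const_nat iter_addr_0 mulr_natl.
Qed.

(** H(n+1) / (n+1) is the Cesaro mean of the null sequence 1, 1/2, 1/3, ... and dominates H(n) /
    (n+1). *)
Lemma harmonic_series_over_n_cvg0 (R : realType) :
  H n / n.+1%:R @[n --> \oo] --> (0 : R).
Proof.
apply: (squeeze_cvgr _ (cvg_cst 0) (cesaro cvg_harmonic)).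
near=> n; rewrite mulr_ge0 ?invr_ge0 ?ler0n//=; last first.
  by rewrite seriesEnat /= sumr_ge0 // => i _; apply: harmonic_ge0.
rewrite /arithmetic_mean /= mulrC ler_wpM2l ?invr_ge0 ?ler0n//.
by rewrite -subr_ge0 harmonic_series_diff_ge0.
Unshelve. all: by end_near. Qed.

(* |H(n-k-1) + H(n+k+e) - 2 H(n)| <= (k+1) (1/(n-k) + 1/(n+1)), and by partial
   fractions the sum over k of 1/((k+1)(n-k)) is 2 H(n) / (n+1). *)
Lemma cubic_weighted_error_cvg0 (R : realType) (c : nat -> R) (e : nat) :
  (e <= 1)%N -> (forall k, 0 <= c k <= k.+1%:R ^- 3) ->
  \sum_(0 <= k < n) c k * (H (n - k.+1)%N + H (n + (k + e))%N - 2 * H n)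
    @[n --> \oo] --> (0 : R).
Proof.
move=> e1 cb.
have bnd n k : (k < n)%N ->
    `|c k * (H (n - k.+1)%N + H (n + (k + e))%N - 2 * H n)| <=
    (k.+1%:R^-1 + (n - k)%:R^-1 + k.+1%:R^-1) / n.+1%:R.
  move=> kn; have /andP[c0 c3] := cb k.
  have k0 : 0 < k.+1%:R :> R by rewrite ltr0n.
  have k1 : 1 <= k.+1%:R :> R by rewrite ler1n.
  have n0 : 0 < n.+1%:R :> R by rewrite ltr0n.
  have nk0 : 0 < (n - k)%:R :> R by rewrite ltr0n subn_gt0.
  have kN0 := lt0r_neq0 k0; have nN0 := lt0r_neq0 n0; have nkN0 := lt0r_neq0 nk0.
  rewrite normrM (ger0_norm c0).
  (* One of the three powers of k + 1 cancels the factor k + 1 of the harmonic estimate. A second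
     one is given up at the end, to reach the form suited to partial fractions. *)
  apply: le_trans (_ : k.+1%:R ^- 2 * ((n - k)%:R^-1 + n.+1%:R^-1) <= _).
    set z := (n - k)%:R^-1 + n.+1%:R^-1.
    rewrite (_ : k.+1%:R ^- 2 * z = k.+1%:R ^- 3 * (k.+1%:R * z)); last first.
      by rewrite (exprSr _ 2) (invfM (_ ^+ 2)) -mulrA mulKf.
    rewrite {}/z; apply: ler_pM => //.
    have := harmonic_series_diff_ge0 R (leq_subr k.+1 n).
    have := harmonic_series_diff_ge0 R (leq_addr (k + e) n).
    have := harmonic_series_diff_le R (leq_subr k.+1 n).
    have := harmonic_series_diff_le R (leq_addr (k + e) n).
    rewrite addKn subKn // (_ : (n - k.+1).+1 = (n - k)%N); last by lia.
    have : (k + e)%:R / n.+1%:R <= k.+1%:R / n.+1%:R :> R.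
      by rewrite ler_pM2r ?invr_gt0 // ler_nat; lia.
    rewrite mulrDr ler_norml.
    move: (k.+1%:R / n.+1%:R) (k.+1%:R / (n - k)%:R) ((k + e)%:R / n.+1%:R)
      (H (n - k.+1)%N) (H (n + (k + e))%N) (H n) => x1 x2 x3 h1 h2 h3.
    by move=> *; apply/andP; split; lra.
  have -> : n.+1%:R = k.+1%:R + (n - k)%:R :> R.
    by rewrite -natrD; congr (_%:R); lia.
  move: k0 k1 kN0 nk0 nkN0.
  move: (k.+1%:R) (n - k)%:R => K L k0 k1 kN0 nk0 nkN0.
  have KL : K + L != 0 by rewrite gt_eqF ?addr_gt0.
  have -> : (K^-1 + L^-1 + K^-1) / (K + L) = K^-1 * (L^-1 + (K + L)^-1).
    by field; rewrite ?kN0 ?KL ?nkN0.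
  rewrite ler_wpM2r //; first by rewrite addr_ge0 // invr_ge0 ltW ?addr_gt0.
  by rewrite lef_pV2 ?posrE ?exprn_gt0 // expr2 ler_peMl // ltW.
apply: norm_cvg0.
apply: (@squeeze_cvgr _ _ _ _ (fun=> 0) (fun n => 3 * (H n / n.+1%:R)));
  [|exact: cvg_cst|]; last first.
  by rewrite -(mulr0 3); apply: cvgMl_tmp; apply: harmonic_series_over_n_cvg0.
near=> n; rewrite normr_ge0 /=.
apply: le_trans (ler_norm_sum _ _ _) _.
apply: (@le_trans _ _ (\sum_(0 <= k < n)
    (k.+1%:R^-1 + (n - k)%:R^-1 + k.+1%:R^-1) / n.+1%:R)).
  by apply: ler_sum_nat => k /andP[_ kn]; exact: bnd.
rewrite -big_distrl !big_split /= [X in _ + X + _]big_nat_rev /=.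
under [X in _ + X + _]eq_big_nat => k /andP[_ kn].
  rewrite (_ : (n - (0 + n - k.+1) = k.+1)%N); last by lia.
  over.
have -> : \sum_(0 <= k < n) k.+1%:R^-1 = H n :> R by rewrite seriesEnat.
by rewrite mulrA ler_pM2r ?invr_gt0 ?ltr0n //; lra.
Unshelve. all: by end_near. Qed.

(** * Harmonic numbers and log 2 *)

(** Both bounds are instances of ln(1 + x) <= x, at x = -1/(n+1) and at x = 1/n. *)
Lemma ln_succ_sub (R : realType) (n : nat) : (0 < n)%N ->
  n.+1%:R^-1 <= ln (n.+1%:R : R) - ln (n%:R : R) <= n%:R^-1.
Proof.
move=> n0; have nr0 : 0 < n%:R :> R by rewrite ltr0n.
have sr0 : 0 < n.+1%:R :> R by rewrite ltr0n.
have nN0 := lt0r_neq0 nr0; have sN0 := lt0r_neq0 sr0.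
rewrite -ln_div ?posrE //; apply/andP; split.
  rewrite -lerN2 -lnV ?posrE ?divr_gt0 // invf_div.
  rewrite (_ : n%:R / n.+1%:R = 1 + - n.+1%:R^-1); last first.
    by rewrite -[n.+1%:R]natr1; field; rewrite natr1.
  apply: le_ln1Dx; rewrite ltrN2 invf_lt1 // ltr1n //.
rewrite -natr1 mulrDl divff // mul1r; apply: le_ln1Dx.
by rewrite (lt_trans (ltrN10 R)) // invr_gt0.
Qed.

(** Each 1/(j+1) lies between ln(j+2) - ln(j+1) and ln(j+1) - ln(j). Summed over n <= j < 2n these
    telescope, to exactly ln 2 above and to at least ln 2 - 1/(n+1) below. *)
Lemma harmonic_series_double_cvg_ln2 (R : realType) :
  H (2 * n)%N - H n @[n --> \oo] --> (ln 2 : R).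
Proof.
apply: (@squeeze_cvgr _ _ _ _ (fun n => ln 2 - harmonic n) (fun=> ln 2));
  [| |exact: cvg_cst]; last first.
  rewrite -[X in _ --> X]subr0.
  by apply: cvgB; [exact: cvg_cst|exact: cvg_harmonic].
near=> n.
have n0 : (0 < n)%N by near: n; exists 1%N.
have -> : H (2 * n)%N - H n = \sum_(n <= j < 2 * n) j.+1%:R^-1 :> R.
  rewrite !seriesEnat /= [X in X - _](big_cat_nat (n := n)) //=; last by lia.
  by rewrite [X in X - _]addrC addrK.
have ln2n m : (0 < m)%N -> ln (2 * m)%:R - ln m%:R = ln 2 :> R.
  by move=> m0; rewrite natrM lnM ?posrE ?ltr0n // addrK.
apply/andP; split; last first.
  rewrite -(ln2n n) // -(@telescope_sumr _ _ _ (fun j => ln (j%:R : R))); last by lia.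
  apply: ler_sum_nat => j /andP[nj _].
  by have /andP[] := @ln_succ_sub R j (leq_trans n0 nj).
apply: le_trans (_ : ln (2 * n).+1%:R - ln n.+1%:R <= _).
  rewrite -(ln2n n.+1) // (_ : (2 * n.+1 = (2 * n).+2)%N); last by lia.
  have /andP[_] := @ln_succ_sub R (2 * n).+1 isT.
  have : (2 * n).+1%:R^-1 <= n.+1%:R^-1 :> R.
    by rewrite lef_pV2 ?posrE ?ltr0n // ler_nat; lia.
  rewrite /harmonic /=; move: (ln (2 * n).+2%:R) (ln (2 * n).+1%:R) (ln n.+1%:R).
  by move: (2 * n).+1%:R^-1 n.+1%:R^-1 => x1 x2 x3 x4 x5; lra.
rewrite -(@telescope_sumr _ _ _ (fun j => ln (j.+1%:R : R))); last by lia.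
by apply: ler_sum_nat => j _; have /andP[] := @ln_succ_sub R j.+1 isT.
Unshelve. all: by end_near. Qed.

(** * Convergence by comparison with inverse squares *)

Lemma cvg_series_le_inv_sq (R : realType) (u : nat -> R) :
  (forall k, `|u k| <= k.+1%:R ^- 2) -> cvgn (series u).
Proof.
move=> ub; apply: normed_cvg.
apply: (series_le_cvg _ _ ub) => [k|k|].
- exact: normr_ge0.
- by rewrite invr_ge0 exprn_ge0 ?ler0n.
apply: nondecreasing_is_cvgn.
  apply: nondecreasing_series => k _ _.
  by rewrite invr_ge0 exprn_ge0 ?ler0n.
exists 2 => _ [n _ <-]; rewrite seriesEnat /=.
case: n => [|n]; first by rewrite big_geq.
(* The bound 2 is strengthened to 2 - 1/(n+1) so that the induction closes by telescoping. *)
apply: (@le_trans _ _ (2 - n.+1%:R^-1)); last by rewrite gerBl invr_ge0 ler0n.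
elim: n => [|n IH]; first by rewrite big_nat1 expr1n invr1; lra.
rewrite big_nat_recr //=.
suff h : n.+2%:R ^- 2 <= n.+1%:R^-1 - n.+2%:R^-1 :> R.
  by apply: le_trans (lerD IH h) _; rewrite addrA subrK.
have n0 : 0 < n.+1%:R :> R by rewrite ltr0n.
rewrite -[n.+2%:R]natr1; move: n.+1%:R n0 => m m0.
have mN0 := lt0r_neq0 m0; have m1 : 0 < m + 1 by rewrite addr_gt0.
have m1N0 := lt0r_neq0 m1.
rewrite (_ : m^-1 - (m + 1)^-1 = (m * (m + 1))^-1); last by field; rewrite ?mN0 ?m1N0.
rewrite lef_pV2 ?posrE ?mulr_gt0 ?exprn_gt0 // expr2 ler_pM2r //; lra.
Qed.

Lemma series_shift1 (R : realType) (F : nat -> R) (n : nat) :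
  \sum_(1 <= i < n.+1) F i = series (fun k => F k.+1) n.
Proof. by rewrite big_add1 seriesEnat. Qed.

Lemma cvg_sum_le_inv_sq (R : realType) (F : nat -> R) :
  (forall n, `|F n.+1| <= n.+1%:R ^- 2) ->
  cvgn (fun N => \sum_(1 <= n < N) F n).
Proof.
move=> Fb; have /cvg_ex[l ul] := cvg_series_le_inv_sq Fb.
apply/cvg_ex; exists l; rewrite -cvg_shiftS.
rewrite (eq_cvg _ _ (g := series (fun k => F k.+1))) // => n.
exact: series_shift1.
Qed.

(** The cutoff n <= 2M contains exactly the first M odd integers, so the limits of the statement can
    be taken along the finite identities. *)
Lemma cvg_sum_below_double_succ (R : realType) (F : nat -> R) :
  (forall n, `|F n.+1| <= n.+1%:R ^- 2) ->
  \sum_(1 <= n < (2 * M).+1) F n @[M --> \oo]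
    --> limn (fun N => \sum_(1 <= n < N) F n).
Proof.
move=> /cvg_sum_le_inv_sq Fl.
have idx : (2 * M).+1 @[M --> \oo] --> \oo.
  apply/cvgnyPge => A; near=> M.
  have : (A <= M)%N by near: M; exact: nbhs_infty_ge.
  by lia.
exact: cvg_comp idx Fl.
Unshelve. all: by end_near. Qed.

Lemma sum_odd_below (R : nmodType) (F : nat -> R) (M : nat) :
  \sum_(1 <= n < (2 * M).+1 | odd n) F n = \sum_(0 <= k < M) F (2 * k).+1.
Proof.
elim: M => [|M IH]; first by rewrite !big_geq.
rewrite big_nat_recr //= -IH (_ : (2 * M.+1).+1 = (2 * M).+3); last by lia.
rewrite big_mkcond /= 2?big_nat_recr //= !oddM /= addr0; congr (_ + _).
by rewrite -big_mkcond.
Qed.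

Lemma expf_inv_le_sq (R : realType) (x n : nat) : (1 < x)%N ->
  n.+1%:R ^- x <= n.+1%:R ^- 2 :> R.
Proof.
move=> x1; rewrite lef_pV2 ?posrE ?exprn_gt0 ?ltr0n //.
by rewrite ler_weXn2l ?ler1n.
Qed.

Lemma harmonic_series_le (R : realType) (n : nat) : 0 <= (H n : R) <= n%:R.
Proof.
have := harmonic_series_diff_le R (leq0n n).
have := harmonic_series_diff_ge0 R (leq0n n).
rewrite seriesEnat /= (big_geq (leqnn 0)) subr0 subn0 divr1.
by move=> -> ->.
Qed.

Lemma sum_odd_harmonic_le (R : realType) (n : nat) :
  0 <= \sum_(1 <= k < n.+1 | odd k) (k%:R : R)^-1 <= n%:R.
Proof.
rewrite sumr_ge0 /= => [|k _]; last by rewrite invr_ge0 ler0n.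
have /andP[_] := harmonic_series_le R n; apply: le_trans.
rewrite (_ : H n = \sum_(1 <= k < n.+1) k%:R^-1); last by rewrite big_add1 seriesEnat.
rewrite big_mkcond /=.
by apply: ler_sum => k _; case: ifP => // _; rewrite invr_ge0 ler0n.
Qed.

(** For the double sums the crude bound h <= n on the inner sum suffices: one power of n + 1 absorbs
    h and an exponent of at least 2 remains. *)
Lemma cube_weight_mul_le (R : realType) (a n : nat) (h : R) : (2 < a)%N ->
  0 <= h <= n%:R -> 0 <= n.+1%:R ^- a * h <= n.+1%:R ^- 2.
Proof.
case: a => [//|a] a2 /andP[h0 hn].
rewrite mulr_ge0 ?invr_ge0 ?exprn_ge0 ?ler0n //=.
apply: le_trans (expf_inv_le_sq R n (a2 : 1 < a)%N).
rewrite exprSr invfM -mulrA ler_piMr ?invr_ge0 ?exprn_ge0 ?ler0n //.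
by rewrite ler_pdivrMl ?ltr0n // mulr1 (le_trans hn) // ler_nat.
Qed.

(** * Truncated zeta and t values and their limits *)

Definition zeta_trunc (R : realType) (x M : nat) : R :=
  \sum_(0 <= k < M) k.+1%:R ^- x.

Definition t_trunc (R : realType) (x M : nat) : R :=
  \sum_(0 <= k < M) (2 * k).+1%:R ^- x.

Lemma cvg_zeta_trunc (R : realType) (x : nat) : (1 < x)%N ->
  zeta_trunc R x M @[M --> \oo] --> limn (zeta_trunc R x).
Proof.
move=> x1; rewrite (_ : zeta_trunc R x = series (fun k => k.+1%:R ^- x)); last first.
  by rewrite seriesEnat.
apply: cvg_series_le_inv_sq => k.
by rewrite ger0_norm ?expf_inv_le_sq // invr_ge0 exprn_ge0 ?ler0n.
Qed.

(** The parity condition moves into the summand, the form required by the convergence lemmas. *)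
Lemma tval_truncE (R : realType) (i : nat) (s : seq nat) :
  tval_trunc R (i :: s) = fun N => \sum_(1 <= n < N)
    (if odd n then n%:R ^- i * tval_trunc R s n else 0).
Proof. by apply/funext => N; rewrite -big_mkcond. Qed.

Lemma cvg_t_trunc (R : realType) (x : nat) : (1 < x)%N ->
  t_trunc R x M @[M --> \oo] --> tval R [:: x].
Proof.
move=> x1; rewrite /tval tval_truncE.
rewrite (eq_cvg _ _ (g := fun M => \sum_(1 <= n < (2 * M).+1)
    (if odd n then n%:R ^- x * tval_trunc R [::] n else 0))); last first.
  move=> M; rewrite -big_mkcond sum_odd_below.
  by apply: eq_bigr => k _; rewrite mulr1.
apply: cvg_sum_below_double_succ => n; case: ifP => _; rewrite /= ?mulr1.
  by rewrite ger0_norm ?expf_inv_le_sq // invr_ge0 exprn_ge0 ?ler0n.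
by rewrite normr0 invr_ge0 exprn_ge0 ?ler0n.
Qed.

Lemma cvg_t_trunc2 (R : realType) (a : nat) : (2 < a)%N ->
  \sum_(0 <= k < M) (2 * k).+1%:R ^- a * \sum_(0 <= j < k) (2 * j).+1%:R^-1
    @[M --> \oo] --> tval R [:: a; 1%N].
Proof.
move=> a2; rewrite /tval tval_truncE.
have inner n : tval_trunc R [:: 1%N] n = \sum_(1 <= k < n | odd k) k%:R^-1.
  by apply: eq_bigr => k _; rewrite mulr1.
rewrite (eq_cvg _ _ (g := fun M => \sum_(1 <= n < (2 * M).+1)
    (if odd n then n%:R ^- a * tval_trunc R [:: 1%N] n else 0))); last first.
  move=> M; rewrite -big_mkcond sum_odd_below.
  by apply: eq_bigr => k _; rewrite inner sum_odd_below.
apply: cvg_sum_below_double_succ => n; rewrite inner; case: ifP => _.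
  have /andP[h0 h2] := cube_weight_mul_le a2 (sum_odd_harmonic_le R n).
  by rewrite ger0_norm.
by rewrite normr0 invr_ge0 exprn_ge0 ?ler0n.
Qed.

Lemma alt_zeta2_truncE (R : realType) (a : nat) :
  alt_zeta2_trunc R a 1 = fun N => \sum_(1 <= m < N)
    (-1) ^+ m * (m%:R ^- a * H m.-1).
Proof.
apply/funext => N; apply: eq_big_nat => -[//|m] _ /=.
rewrite big_add1 seriesEnat /= mulrA big_distrr /=; apply: eq_bigr => n _.
by rewrite invfM mulrA expr1.
Qed.

Lemma cvg_alt_zeta2_trunc (R : realType) (a : nat) : (2 < a)%N ->
  alt_zeta2_trunc R a 1 (2 * M).+1 @[M --> \oo] --> alt_zeta2 R a 1.
Proof.
move=> a2; rewrite /alt_zeta2 alt_zeta2_truncE.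
apply: cvg_sum_below_double_succ => n.
rewrite normrM normrX normrN1 expr1n mul1r.
have /andP[h0 h2] := cube_weight_mul_le a2 (harmonic_series_le R n).
by rewrite ger0_norm.
Qed.

(** The integers up to 2M are split by parity; the even ones are twice the integers up to M. *)
Lemma zeta_trunc_double (R : realType) (x M : nat) :
  zeta_trunc R x (2 * M) = t_trunc R x M + 2 ^- x * zeta_trunc R x M.
Proof.
rewrite /zeta_trunc /t_trunc; elim: M => [|M IH].
  by rewrite !big_geq // mulr0 addr0.
rewrite (_ : (2 * M.+1 = (2 * M).+2)%N); last by lia.
rewrite !big_nat_recr //= IH mulrDr -invfM -exprMn -natrM.
rewrite (_ : (2 * M.+1 = (2 * M).+2)%N); last by lia.
by rewrite -!addrA; congr (_ + _); rewrite addrCA.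
Qed.

Lemma tval1_zeta (R : realType) (x : nat) : (1 < x)%N ->
  tval R [:: x] = (1 - 2 ^- x) * limn (zeta_trunc R x).
Proof.
move=> x1; have zx := cvg_zeta_trunc x1 (R := R).
have z2 := cvg_comp _ _ (@cvg_mulnl 2 isT) zx.
rewrite -(cvg_lim (@Rhausdorff R) (cvg_t_trunc (R := R) x1)).
apply: cvg_lim => //.
rewrite (eq_cvg _ _ (g := fun M =>
  zeta_trunc R x (2 * M) - 2 ^- x * zeta_trunc R x M)); last first.
  by move=> M; rewrite zeta_trunc_double addrK.
by rewrite mulrBl mul1r; apply: cvgB => //; apply: cvgMl_tmp.
Qed.

(** * Finite identities with error terms *)

(** The weighted truncation error of the kernel sums. The shifts [k + 1] here and [k + 0] in
    [t_error] are the cases e = 1 and e = 0 of [cubic_weighted_error_cvg0]. *)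
Definition zeta_error (R : realType) (a M : nat) : R :=
  \sum_(0 <= k < M) k.+1%:R ^- a *
    (H (M - k.+1)%N + H (M + (k + 1))%N - 2 * H M).

Definition t_error (R : realType) (a M : nat) : R :=
  \sum_(0 <= k < M) (2 * k).+1%:R ^- a *
    (H (M - k.+1)%N + H (M + (k + 0))%N - 2 * H M).

Lemma cvg_zeta_error (R : realType) (a : nat) : (2 < a)%N ->
  zeta_error R a M @[M --> \oo] --> 0.
Proof.
move=> a2; apply: cubic_weighted_error_cvg0 => // k.
rewrite invr_ge0 exprn_ge0 ?ler0n //= lef_pV2 ?posrE ?exprn_gt0 ?ltr0n //.
by rewrite ler_weXn2l ?ler1n.
Qed.

Lemma cvg_t_error (R : realType) (a : nat) : (2 < a)%N ->
  t_error R a M @[M --> \oo] --> 0.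
Proof.
move=> a2; apply: cubic_weighted_error_cvg0 => // k.
rewrite invr_ge0 exprn_ge0 ?ler0n //= lef_pV2 ?posrE ?exprn_gt0 ?ltr0n //.
apply: (@le_trans _ _ ((2 * k).+1%:R ^+ 3)); last by rewrite ler_weXn2l ?ler1n.
by rewrite lerXn2r ?nnegrE ?ler0n // ler_nat; lia.
Qed.

Lemma harmonic_series_double (R : realType) (M : nat) :
  H (2 * M)%N = \sum_(0 <= j < M) (2 * j).+1%:R^-1 + 2^-1 * H M :> R.
Proof.
have Hz n : H n = zeta_trunc R 1 n by rewrite seriesEnat.
by rewrite !Hz zeta_trunc_double.
Qed.

(** Truncated Euler formula, from c k = k + 1. The 1/2 comes from twice 1 / (4 (k+1)), and the last
    sum is the truncation of zeta(2K+3, 1). *)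
Lemma zeta_trunc_products (R : realType) (K M : nat) :
  \sum_(0 <= i < K) zeta_trunc R (2 * i + 3) M * zeta_trunc R (2 * (K - i) + 1) M =
  (K%:R + 2^-1) * zeta_trunc R (2 * K + 4) M + zeta_error R (2 * K + 3) M
  - 2 * \sum_(0 <= k < M) k.+1%:R ^- (2 * K + 3) * H k.
Proof.
rewrite (@sum_products_odd_exponents _ (fun k => k.+1%:R)); first last.
- by move=> j; rewrite ltr0n.
- by move=> i j /eqP; rewrite eqr_nat => /eqP[].
rewrite (mulrDl K%:R) -/(zeta_trunc R (2 * K + 4) M) -!addrA; congr (_ + _).
rewrite /zeta_error /zeta_trunc [LHS]mulr_sumr [X in X + _]mulr_sumr.
rewrite [X in _ = _ + (_ - X)]mulr_sumr -[X in _ = _ + (_ + X)]sumrN -!big_split /=.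
apply: eq_big_nat => k /andP[_ kM].
rewrite sum_kernel_all // addn1 (_ : (2 * K + 4 = (2 * K + 3).+1)%N); last by lia.
rewrite (exprSr _ (2 * K + 3)) (invfM (_ ^+ _)).
have : k.+1%:R != 0 :> R by rewrite pnatr_eq0.
move: (k.+1%:R ^- (2 * K + 3)) (H _) (H _) (H _) (H _) => w h1 h2 h3 h4.
by move: k.+1%:R => m mN0; field.
Qed.

(** The case c k = 2k + 1. As H(k) is twice the sum of 1/n over even n < 2k + 1, the sum with H(k)
    is twice the mixed sum over odd m > even n. *)
Lemma t_trunc_products (R : realType) (K M : nat) :
  \sum_(0 <= i < K) t_trunc R (2 * i + 3) M * t_trunc R (2 * (K - i) + 1) M =
  (K%:R + 3 / 2) * t_trunc R (2 * K + 4) M + 2^-1 * t_error R (2 * K + 3) M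
  - \sum_(0 <= k < M) (2 * k).+1%:R ^- (2 * K + 3) * H k
  - 2 * t_trunc R (2 * K + 3) M * (H (2 * M)%N - H M).
Proof.
have -> : H (2 * M)%N - H M =
    \sum_(0 <= j < M) (2 * j).+1%:R^-1 - 2^-1 * H M :> R.
  rewrite harmonic_series_double; lra.
rewrite (@sum_products_odd_exponents _ (fun k => (2 * k).+1%:R)); first last.
- by move=> j; rewrite ltr0n.
- by move=> i j /eqP; rewrite eqr_nat => /eqP; lia.
rewrite (mulrDl K%:R) -/(t_trunc R (2 * K + 4) M) -!addrA; congr (_ + _).
set L := _ - 2^-1 * H M; rewrite /t_error /t_trunc (mulrAC 2).
rewrite [LHS]mulr_sumr [X in X + _]mulr_sumr [X in _ + (X + _)]mulr_sumr.
rewrite [2 * L * _]mulr_sumr -!sumrN -!big_split /=.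
apply: eq_big_nat => k /andP[_ kM].
rewrite sum_kernel_odd // -/L addn0 (_ : (2 * K + 4 = (2 * K + 3).+1)%N); last by lia.
rewrite (exprSr _ (2 * K + 3)) (invfM (_ ^+ _)).
have : (2 * k).+1%:R != 0 :> R by rewrite pnatr_eq0.
move: L (_ ^- (2 * K + 3)) (H _) (H _) (H _) (H _) => L w h1 h2 h3 h4.
by move: (2 * k).+1%:R => m mN0; field.
Qed.

(** On the left the terms with even m cancel and those with odd m = 2k + 1 double. Their inner sum
    H(2k) is then split into its odd part and H(k) / 2. *)
Lemma harmonic_sums_double (R : realType) (a M : nat) :
  \sum_(0 <= k < 2 * M) k.+1%:R ^- a * H k - alt_zeta2_trunc R a 1 (2 * M).+1 =
  2 * (\sum_(0 <= k < M) (2 * k).+1%:R ^- a * \sum_(0 <= j < k) (2 * j).+1%:R^-1)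
  + \sum_(0 <= k < M) (2 * k).+1%:R ^- a * H k.
Proof.
rewrite alt_zeta2_truncE big_add1 /=; elim: M => [|M IH].
  by rewrite !big_geq // mulr0 subrr addr0.
rewrite (_ : (2 * M.+1 = (2 * M).+2)%N); last by lia.
rewrite !big_nat_recr //= mulrDr.
rewrite harmonic_series_double.
rewrite !exprS exprM sqrrN !expr1n.
move: IH; set s1 := \sum_(0 <= k < 2 * M) _; set s2 := \sum_(0 <= k < 2 * M) _.
set s3 := \sum_(0 <= k < M) _ * \sum_(0 <= j < k) _; set s4 := \sum_(0 <= k < M) _.
set s5 := \sum_(0 <= k < M) _.
move: (H (2 * M).+1) (_ ^- a) (_ ^- a) (H M) => *; lra.
Qed.

(** The three preceding identities, the zeta one taken at 2M, are linear; solving them eliminates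
    both the zeta(2K+3, 1) sum and the mixed sum. *)
Lemma t_double_trunc_eq (R : realType) (K M : nat) :
  \sum_(0 <= k < M) (2 * k).+1%:R ^- (2 * K + 3) *
    \sum_(0 <= j < k) (2 * j).+1%:R^-1 =
  4^-1 * ((K%:R + 2^-1) * zeta_trunc R (2 * K + 4) (2 * M)
    + zeta_error R (2 * K + 3) (2 * M)
    - \sum_(0 <= i < K) zeta_trunc R (2 * i + 3) (2 * M) *
                        zeta_trunc R (2 * (K - i) + 1) (2 * M))
  - 2^-1 * alt_zeta2_trunc R (2 * K + 3) 1 (2 * M).+1
  - 2^-1 * ((K%:R + 3 / 2) * t_trunc R (2 * K + 4) M
    + 2^-1 * t_error R (2 * K + 3) M
    - 2 * t_trunc R (2 * K + 3) M * (H (2 * M)%N - H M)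
    - \sum_(0 <= i < K) t_trunc R (2 * i + 3) M * t_trunc R (2 * (K - i) + 1) M).
Proof.
have := harmonic_sums_double R (2 * K + 3) M.
rewrite zeta_trunc_products t_trunc_products.
set x1 := \sum_(0 <= k < M) _ * \sum_(0 <= j < k) _.
set x2 := \sum_(0 <= k < 2 * M) _ * _; set x3 := \sum_(0 <= k < M) _ * H _.
move: x1 x2 x3 (alt_zeta2_trunc _ _ _ _) (zeta_error _ _ _) (t_error _ _ _)
  (2 * t_trunc R (2 * K + 3) M * _) => *; lra.
Qed.

(** * Passage to the limit *)

Lemma cvg_sum_nat (R : realType) (K : nat) (F : nat -> nat -> R) (l : nat -> R) :
  (forall i, (i < K)%N -> F i M @[M --> \oo] --> l i) ->
  \sum_(0 <= i < K) F i M @[M --> \oo] --> \sum_(0 <= i < K) l i.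
Proof.
elim: K => [|K IH] Fl.
  rewrite big_geq // (eq_cvg _ _ (g := fun=> 0)); first exact: cvg_cst.
  by move=> M; rewrite big_geq.
rewrite (eq_cvg _ _ (g := fun M => \sum_(0 <= i < K) F i M + F K M)); last first.
  by move=> M; rewrite big_nat_recr.
rewrite big_nat_recr //=; apply: cvgD; last exact: Fl.
by apply: IH => i iK; apply: Fl; exact: ltnW.
Qed.

(** The termwise limit of [t_double_trunc_eq]; the zeros are the limits of the two errors, kept so
    that both sides match in shape. *)
Lemma tval_depth2_limit (R : realType) (K : nat) :
  tval R [:: (2 * K + 3)%N; 1%N] =
  4^-1 * ((K%:R + 2^-1) * limn (zeta_trunc R (2 * K + 4)) + 0
    - \sum_(0 <= i < K) limn (zeta_trunc R (2 * i + 3)) *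
                        limn (zeta_trunc R (2 * (K - i) + 1)))
  - 2^-1 * alt_zeta2 R (2 * K + 3) 1
  - 2^-1 * ((K%:R + 3 / 2) * tval R [:: (2 * K + 4)%N] + 2^-1 * 0
    - 2 * tval R [:: (2 * K + 3)%N] * ln 2
    - \sum_(0 <= i < K) tval R [:: (2 * i + 3)%N] *
                        tval R [:: (2 * (K - i) + 1)%N]).
Proof.
have a2 : (2 < 2 * K + 3)%N by lia.
have cz2 x : (1 < x)%N -> zeta_trunc R x (2 * M) @[M --> \oo]
    --> limn (zeta_trunc R x).
  by move=> x1; exact: (cvg_comp _ _ (@cvg_mulnl 2 isT) (cvg_zeta_trunc x1 (R := R))).
have ce2 : zeta_error R (2 * K + 3) (2 * M) @[M --> \oo] --> 0.
  exact: (cvg_comp _ _ (@cvg_mulnl 2 isT) (cvg_zeta_error a2 (R := R))).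
rewrite -(cvg_lim (@Rhausdorff R) (cvg_t_trunc2 (R := R) a2)).
apply: cvg_lim => //.
rewrite (eq_cvg _ _ (t_double_trunc_eq R K)).
apply: cvgB; [apply: cvgB|]; apply: cvgMl_tmp.
- apply: cvgB; [apply: cvgD|].
  + by apply: cvgMl_tmp; apply: cz2; lia.
  + exact: ce2.
  + apply: cvg_sum_nat => i iK.
    by apply: cvgM; apply: cz2; lia.
- exact: cvg_alt_zeta2_trunc.
- apply: cvgB; [apply: cvgB; [apply: cvgD|]|].
  + by apply: cvgMl_tmp; apply: cvg_t_trunc; lia.
  + by apply: cvgMl_tmp; apply: cvg_t_error.
  + apply: cvgM; last exact: harmonic_series_double_cvg_ln2.
    by apply: cvgMl_tmp; apply: cvg_t_trunc; lia.
  + apply: cvg_sum_nat => i iK.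
    by apply: cvgM; apply: cvg_t_trunc; lia.
Qed.

(** * Coefficients and the final formula *)

(** With X = 2^x and Y = 2^y, zeta(x) = X t(x) / (X - 1), and (X-1)(Y-1) - XY/2 = XY/2 - X - Y + 1,
    where c stands for XY/2. *)
Lemma coefficient_tval_product (R : realType) (x y : nat) (c : R) :
  (1 < x)%N -> (1 < y)%N -> 2 * c = 2 ^+ x * 2 ^+ y ->
  (c - 2 ^+ x - 2 ^+ y + 1) / ((2 ^+ x - 1) * (2 ^+ y - 1))
    * tval R [:: x] * tval R [:: y] =
  tval R [:: x] * tval R [:: y]
  - 2^-1 * (limn (zeta_trunc R x) * limn (zeta_trunc R y)).
Proof.
move=> x1 y1 cE; rewrite !tval1_zeta //.
have neq n : (1 < n)%N -> 2 ^+ n != 0 :> R /\ 2 ^+ n - 1 != 0 :> R.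
  move=> n1; rewrite expf_neq0 ?pnatr_eq0 // subr_eq0 gt_eqF //.
  by rewrite exprn_egt1 ?ltr1n //; case: n n1.
have [] := neq _ x1; have [] := neq _ y1.
have -> : c = 2^-1 * (2 ^+ x * 2 ^+ y) by rewrite -cE mulKf ?pnatr_eq0.
move: (limn _) (limn _) => zx zy.
move: (2 ^+ x) (2 ^+ y) => X Y Y0 Y1 X0 X1.
by field; rewrite ?X0 ?X1 ?Y0 ?Y1.
Qed.

Theorem theorem6p5 (R : realType) (p : nat) (hp0 : (0 < p)%N)
    (hp : ~~ odd p) :
  tval R [:: (p + 1)%N; 1%N] =
    tval R [:: (p + 1)%N] * ln 2
    - 1 / 2 * alt_zeta2 R (p + 1) 1
    + ((p + 1)%:R * (1 - 2 ^+ (p + 1)) - 2 ^+ (p + 2))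
        / (4 * (2 ^+ (p + 2) - 1)) * tval R [:: (p + 2)%N]
    + 1 / 2 * \sum_(1 <= i < ((p - 2) %/ 2).+1)
        ((2 ^+ (p + 1) - 2 ^+ (2 * i + 1) - 2 ^+ (p + 1 - 2 * i) + 1)
          / ((2 ^+ (2 * i + 1) - 1) * (2 ^+ (p + 1 - 2 * i) - 1))
          * tval R [:: (2 * i + 1)%N] * tval R [:: (p + 1 - 2 * i)%N]).
Proof.
(* K is the number of terms of the sum, 0 when p = 2. *)
have [K ->] : exists K, p = (2 * K + 2)%N by exists ((p - 2) %/ 2)%N; lia.
rewrite (_ : (2 * K + 2 - 2) %/ 2 = K)%N; last by lia.
rewrite (_ : 2 * K + 2 + 1 = 2 * K + 3)%N; last by lia.
rewrite (_ : 2 * K + 2 + 2 = (2 * K + 3).+1)%N; last by lia.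
rewrite big_add1 /= tval_depth2_limit.
under [in RHS]eq_big_nat => i /andP[_ iK].
  rewrite (_ : 2 * i.+1 + 1 = 2 * i + 3)%N; last by lia.
  rewrite (_ : 2 * K + 3 - 2 * i.+1 = 2 * (K - i) + 1)%N; last by lia.
  (* The two exponents add up to p + 2, so c is 2^(p+1). *)
  rewrite coefficient_tval_product; first last.
  - by rewrite -exprS -exprD; congr (_ ^+ _); lia.
  - by lia.
  - by lia.
  over.
rewrite sumrB -mulr_sumr (_ : 2 * K + 4 = (2 * K + 3).+1)%N; last by lia.
(* Expressing t(p+2) by zeta(p+2) merges the two terms of weight p + 2; a rational identity in X =
   2^(p+1) and K remains. *)
rewrite [tval R [:: (2 * K + 3).+1]]tval1_zeta; last by lia.
have : 2 ^+ (2 * K + 3).+1 - 1 != 0 :> R.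
  by rewrite subr_eq0 gt_eqF // exprn_egt1 ?ltr1n.
have : 2 ^+ (2 * K + 3) != 0 :> R by rewrite expf_neq0 ?pnatr_eq0.
rewrite exprS [(2 * K + 3)%:R]natrD natrM.
move: (\sum_(_ <= _ < _) _) (\sum_(_ <= _ < _) _) (limn _) (tval _ _) (ln 2)
  (alt_zeta2 _ _ _) => x1 x2 x3 x4 x5 x6.
move: (2 ^+ (2 * K + 3)) K%:R => X k XN0 X1N0.
by field; rewrite ?XN0 ?X1N0.
Qed.
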